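(* Let $q$ be an odd prime power, $n$ a positive integer, and $f(x,y,z)=x+yz$ viewed as a function from $M_n(\mathbb{F}_q)^3$ to $M_n(\mathbb{F}_q)$. There are constants $C_0,c>0$ (independent of $q$ and the sets) such that for all $A,B,C\subset M_n(\mathbb{F}_q)$ with $|A||B||C|\ge C_0\, q^{3n^2-1}$ we have $|f(A,B,C)|\ge c\, q^{n^2}$.
   Context: $M_n(\mathbb{F}_q)$ is the ring of $n\times n$ matrices over $\mathbb{F}_q$, and $f(A,B,C)=\{a+bc: a\in A,b\in B,c\in C\}$. *)

(* Defs.v *)
From HB Require Import structures.
From mathcomp Require Import all_boot all_order all_algebra.
From mathcomp Require Import reals.

Set Implicit Arguments.
Unset Strict Implicit.
Unset Printing Implicit Defensive.

Import GRing.Theory Num.Theory.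
Local Open Scope ring_scope.

Definition fxyz (F : finFieldType) (n : nat) (x y z : 'M[F]_n) : 'M[F]_n :=
  x + y *m z.

Definition fset3 (F : finFieldType) (n : nat) (A B C : {set 'M[F]_n})
    : {set 'M[F]_n} :=
  [set fxyz p.1.1 p.1.2 p.2 | p in setX (setX A B) C].

Lemma fset3P (F : finFieldType) (n : nat) (A B C : {set 'M[F]_n})
    (m : 'M[F]_n) :
  reflect (exists a b c, [/\ a \in A, b \in B, c \in C & m = a + b *m c])
          (m \in fset3 A B C).
Proof.
apply: (iffP imsetP) => [[[[a b] c]]|[a [b [c [aA bB cC ->]]]]].
  by rewrite !inE /= => /andP[/andP[aA bB] cC] ->; exists a, b, c.
by exists (a, b, c); rewrite // !inE /= aA bB cC.
Qed.

(* Main.v *)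
(** Put [Q = q ^ (n ^ 2)], [S = f(A, B, C)], and let [deg (c, a)] be the number
    of [b] in [B] with [a + b c] in [S].  Summed over all [Q ^ 2] pairs, [deg]
    has total [Q |B| |S|], and its second moment counts the solutions of
    [s' - s = (b' - b) c]: when [b' - b] is invertible each pair
    [(s, s')] determines [c], so there are exactly [|S| ^ 2] solutions, and
    otherwise at most [Q |S|].  As only [O(Q / q)] matrices are singular, the
    variance of [deg] is small.  But [deg = |B|] on all of [C * A], which is far
    from the mean [|B| |S| / Q] unless [S] has positive density. *)
Require Import Defs.
From HB Require Import structures.
From mathcomp Require Import all_boot all_order all_algebra.
From mathcomp Require Import reals.
From mathcomp Require Import fingroup ring lra.

Set Implicit Arguments.
Unset Strict Implicit.
Unset Printing Implicit Defensive.

Import Order.TTheory GRing.Theory Num.Theory.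
Local Open Scope ring_scope.

(** The bound [1 - 2 * x] alone does not survive multiplication by a further factor below 1. The
    term [x ^+ n.+1] is slack that pays for the next factor and makes the induction close. *)
Lemma prod_1subX_ge (R : realFieldType) (x : R) (n : nat) :
  0 <= x -> 2 * x <= 1 ->
  1 - 2 * x + x ^+ n.+1 <= \prod_(i < n.+1) (1 - x ^+ i.+1).
Proof.
move=> x0 x1; elim: n => [|n IH]; first by rewrite big_ord1 expr1; lra.
rewrite big_ord_recr /=.
have y0 : 0 <= x ^+ n.+1 by rewrite exprn_ge0.
have y1 : x ^+ n.+1 <= x.
  by rewrite exprS ler_piMr // exprn_ile1 //; lra.
rewrite [in X in X <= _](exprS x n.+1) [x ^+ n.+2](exprS x n.+1).
move: IH; set y := x ^+ n.+1 in y0 y1 *; set p := \prod_(_ < _) _ => IH.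
have xy : x * y <= 1 by nra.
have : (1 - 2 * x + y) * (1 - x * y) <= p * (1 - x * y).
  by rewrite ler_wpM2r // subr_ge0.
apply: le_trans; have : 0 <= y * (1 - 2 * x + x * (2 * x - y)).
  by apply: mulr_ge0 => //; nra.
by nra.
Qed.

Lemma card_unitmx (R : realFieldType) (F : finFieldType) (n : nat) :
  #|[set D : 'M[F]_n.+1 | D \in unitmx]|%:R =
  #|F|%:R ^+ (n.+1 ^ 2) * \prod_(i < n.+1) (1 - #|F|%:R^-1 ^+ i.+1) :> R.
Proof.
have q0 : #|F|%:R != 0 :> R.
  by rewrite pnatr_eq0 -lt0n (ltn_trans _ (card_finNzRing_gt1 F)).
have -> : #|[set D : 'M[F]_n.+1 | D \in unitmx]| = #|'GL_n.+1[F]%g|.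
  by rewrite cardsT /= card_sub; apply: eq_card => D; rewrite inE.
rewrite card_GL // big_add1 /= big_mkord natrM natrX natr_prod.
(* The order of GL contains [q] to the binomial power; taking [q ^+ i.+1] out of each factor
   [q ^+ i.+1 - 1] supplies the remaining exponent. *)
have -> : (n.+1 ^ 2 = 'C(n.+1, 2) + \sum_(i < n.+1) i.+1)%N.
  elim: n => [|n IH]; first by rewrite big_ord1.
  by rewrite big_ord_recr binS bin1 /= addnACA -IH; ring.
rewrite exprD -mulrA; congr (_ * _).
rewrite expr_sum -big_split /=; apply: eq_bigr => i _.
rewrite natrB ?expn_gt0 ?(ltn_trans _ (card_finNzRing_gt1 F)) // natrX.
by rewrite mulrBr mulr1 -exprMn divff // expr1n.
Qed.

(** By [prod_1subX_ge] at [x = 1 / q], invertible matrices have density at least [1 - 2 / q]. *)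
Lemma card_singular_le (R : realFieldType) (F : finFieldType) (n : nat) :
  #|F|%:R * #|[set D : 'M[F]_n | D \notin unitmx]|%:R <=
  2 * #|F|%:R ^+ (n ^ 2) :> R.
Proof.
have q2 : 2 <= #|F|%:R :> R by rewrite ler_nat card_finNzRing_gt1.
case: n => [|n].
  rewrite (_ : [set D | _] = set0) ?cards0 ?mulr0 ?expr0 ?mulr1 //.
  by apply/setP => D; rewrite !inE [D]flatmx0 -(flatmx0 1%:M) unitmx1.
have -> : [set D : 'M[F]_n.+1 | D \notin unitmx] = ~: [set D | D \in unitmx].
  by apply/setP => D; rewrite !inE.
have := cardsC [set D : 'M[F]_n.+1 | D \in unitmx].
rewrite card_mx => /(congr1 (fun k => k%:R : R)).
rewrite natrD natrX mulnn card_unitmx.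
set q := #|F|%:R in q2 *; set Q := q ^+ _; set s := _%:R.
have qV : q * q^-1 = 1 by rewrite divff //; lra.
have x0 : 0 <= q^-1 by rewrite invr_ge0; lra.
have x1 : 2 * q^-1 <= 1 by nra.
have := prod_1subX_ge n x0 x1.
have := exprn_ge0 n.+1 x0.
set p := \prod_(_ < _) _; set y := q^-1 ^+ _ => y0 hp hQ.
have Q0 : 0 <= Q by rewrite exprn_ge0 //; lra.
have -> : s = Q * (1 - p) by rewrite mulrBr mulr1 -{1}hQ addrAC subrr add0r.
have hp' : 1 - p <= 2 * q^-1 by lra.
have -> : 2 * Q = q * (Q * (2 * q^-1)) by rewrite -[LHS]mulr1 -qV; ring.
by rewrite ler_wpM2l ?ler_wpM2l //; lra.
Qed.

Section Incidence.
Variables (R : realFieldType) (F : finFieldType) (n : nat).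
Implicit Types (B S : {set 'M[F]_n}) (a b c : 'M[F]_n).

Local Notation Q := (#|F|%:R ^+ (n ^ 2) : R).
Local Notation singular := [set D : 'M[F]_n | D \notin unitmx].

Definition indic S a : R := (a \in S)%:R.
Definition deg B S c a : R := \sum_(b in B) indic S (a + b *m c).

Lemma sum_indic S : \sum_a indic S a = #|S|%:R.
Proof.
rewrite -sum1_card natr_sum [RHS]big_mkcond; apply: eq_bigr => a _.
by rewrite /indic; case: (a \in S).
Qed.

Lemma sum_const_mx (x : R) : \sum_(c : 'M[F]_n) x = Q * x.
Proof. by rewrite sumr_const card_mx -[LHS]mulr_natl natrX mulnn. Qed.

Lemma sum_deg B S : \sum_c \sum_a deg B S c a = Q * (#|B|%:R * #|S|%:R).
Proof.
rewrite -sum_const_mx; apply: eq_bigr => c _.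
rewrite /deg exchange_big /= mulr_natl -sumr_const; apply: eq_bigr => b _.
by rewrite -(sum_indic S) [RHS](reindex_inj (addIr (b *m c))).
Qed.

(** After translating [a] by [b *m c], the map sending [c] to [a + (b' - b) *m c] is a bijection for
    each fixed [a], so the two indicators decouple. *)
Lemma pair_corr_unit S b b' : b' - b \in unitmx ->
  \sum_c \sum_a indic S (a + b *m c) * indic S (a + b' *m c) = #|S|%:R ^+ 2.
Proof.
move=> D_unit.
transitivity (\sum_c \sum_a indic S a * indic S (a + (b' - b) *m c)).
  apply: eq_bigr => c _; rewrite [RHS](reindex_inj (addIr (b *m c))) /=.
  by apply: eq_bigr => a _; rewrite mulmxBl -addrA subrKC.
rewrite exchange_big /= expr2 -{1}(sum_indic S) mulr_suml.
apply: eq_bigr => a _; rewrite -mulr_sumr -(sum_indic S); congr (_ * _).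
rewrite [RHS](reindex_inj (addrI a)) [RHS](reindex_inj (can_inj (mulKmx D_unit))).
by [].
Qed.

Lemma pair_corr_le S b b' :
  \sum_c \sum_a indic S (a + b *m c) * indic S (a + b' *m c) <= Q * #|S|%:R.
Proof.
rewrite -sum_const_mx; apply: ler_sum => c _.
rewrite -(sum_indic S) [X in _ <= X](reindex_inj (addIr (b *m c))) /=.
by apply: ler_sum => a _; rewrite ler_piMr ?ler0n // /indic lern1 leq_b1.
Qed.

Lemma sum_deg_sqr_le B S :
  \sum_c \sum_a deg B S c a ^+ 2 <=
  (#|B|%:R * #|S|%:R) ^+ 2 + #|B|%:R * #|singular|%:R * (Q * #|S|%:R).
Proof.
have -> : \sum_c \sum_a deg B S c a ^+ 2 = \sum_(b in B) \sum_(b' in B)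
    \sum_c \sum_a indic S (a + b *m c) * indic S (a + b' *m c).
  under eq_bigr => c _ do under eq_bigr => a _ do
    (rewrite expr2 /deg mulr_suml; under eq_bigr => b _ do rewrite mulr_sumr).
  under eq_bigr => c _ do rewrite exchange_big /=.
  rewrite exchange_big /=; apply: eq_bigr => b _.
  under eq_bigr => c _ do rewrite exchange_big /=.
  by rewrite exchange_big.
rewrite [X in _ <= X](_ : _ = #|B|%:R *
  (#|B|%:R * #|S|%:R ^+ 2 + #|singular|%:R * (Q * #|S|%:R))); last by ring.
rewrite mulr_natl -sumr_const; apply: ler_sum => b _.
have -> : #|B|%:R * #|S|%:R ^+ 2 = \sum_(b' in B) #|S|%:R ^+ 2 :> R.
  by rewrite sumr_const mulr_natl.
(* For fixed [b], the bad [b'] are counted over all matrices rather than over [B]; the surplus is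
   nonnegative. *)
have -> : #|singular|%:R = \sum_(b' : 'M_n) indic singular (b' - b).
  by rewrite -(sum_indic singular) [LHS](reindex_inj (addIr (- b))).
rewrite mulr_suml.
apply: (@le_trans _ _ (\sum_(b' in B)
   (#|S|%:R ^+ 2 + indic singular (b' - b) * (Q * #|S|%:R)))).
  apply: ler_sum => b' _; rewrite /indic inE.
  have [/pair_corr_unit->|_] := boolP (b' - b \in unitmx).
    by rewrite mul0r addr0.
  by rewrite mul1r (le_trans (pair_corr_le _ _ _)) // lerDr exprn_ge0 ?ler0n.
rewrite big_split lerD2l /= [X in _ <= X](bigID (mem B)) /= lerDl.
by apply: sumr_ge0 => b' _; rewrite !mulr_ge0 ?exprn_ge0 ?ler0n.
Qed.

(** Deviations from the mean are scaled by [Q] to avoid division. The invertible pairs contribute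
    [(Q * m) ^+ 2], which the squared mean cancels exactly, leaving only the singular pairs. *)
Lemma deg_variance_le B S :
  \sum_c \sum_a (Q * deg B S c a - #|B|%:R * #|S|%:R) ^+ 2 <=
  Q ^+ 3 * #|B|%:R * #|S|%:R * #|singular|%:R.
Proof.
set m := #|B|%:R * #|S|%:R.
have -> : \sum_c \sum_a (Q * deg B S c a - m) ^+ 2 =
    Q ^+ 2 * (\sum_c \sum_a deg B S c a ^+ 2) - (Q * m) ^+ 2.
  transitivity (Q ^+ 2 * (\sum_c \sum_a deg B S c a ^+ 2) -
     2 * Q * m * (\sum_c \sum_a deg B S c a) + \sum_(c : 'M[F]_n) Q * m ^+ 2).
    rewrite !mulr_sumr -sumrB -big_split /=; apply: eq_bigr => c _.
    rewrite -sum_const_mx !mulr_sumr -sumrB -big_split /=.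
    by apply: eq_bigr => a _; ring.
  by rewrite sum_const_mx sum_deg -/m; ring.
have := ler_wpM2l (sqr_ge0 Q) (sum_deg_sqr_le B S).
rewrite -/m; set d := \sum_c _; move: m => m; lra.
Qed.

Lemma deg_fset3 (A B C : {set 'M[F]_n}) c a :
  c \in C -> a \in A -> deg B (fset3 A B C) c a = #|B|%:R.
Proof.
move=> cC aA; rewrite /deg -sum1_card natr_sum; apply: eq_bigr => b bB.
by rewrite /indic (_ : _ \in _) //; apply/fset3P; exists a, b, c.
Qed.

(** Only the pairs in [C] times [A] are kept in the variance; each has degree [#|B|] and so
    contributes the same square. *)
Lemma fset3_energy_le (A B C : {set 'M[F]_n}) :
  (#|A| * #|C|)%:R * (#|B|%:R * (Q - #|fset3 A B C|%:R)) ^+ 2 <=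
  Q ^+ 3 * #|B|%:R * #|fset3 A B C|%:R * #|singular|%:R.
Proof.
apply: le_trans (deg_variance_le B (fset3 A B C)).
rewrite mulnC natrM -mulrA [X in _ <= X](bigID (mem C)) /=.
rewrite mulr_natl -sumr_const ler_wpDr //.
  by apply: sumr_ge0 => c _; apply: sumr_ge0 => a _; exact: sqr_ge0.
apply: ler_sum => c cC; rewrite [X in _ <= X](bigID (mem A)) /=.
rewrite mulr_natl -sumr_const ler_wpDr //.
  by apply: sumr_ge0 => a _; exact: sqr_ge0.
by apply: ler_sum => a aA; rewrite deg_fset3 // mulrBr [Q * _]mulrC.
Qed.

End Incidence.

Theorem theorem1p10 (R : realType) (n : nat) (n_gt0 : (0 < n)%N) :
  exists C0 c : R, [/\ 0 < C0, 0 < c &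
    forall (F : finFieldType) (A B C : {set 'M[F]_n}),
      odd #|F| ->
      C0 * #|F|%:R ^+ (3 * n ^ 2 - 1) <= (#|A| * #|B| * #|C|)%:R ->
      c * #|F|%:R ^+ (n ^ 2) <= #|fset3 A B C|%:R].
Proof.
(* If the image had fewer than [Q / 2] elements, the constant 4 would put the left side of the
   energy bound, multiplied by [q] and divided by [#|B|], above [Q ^+ 5], while the right side is at
   most [Q ^+ 5]. *)
exists 4, (1 / 2); split; [lra | lra | move=> F A B C _ hABC].
have q2 : 2 <= #|F|%:R :> R by rewrite ler_nat card_finNzRing_gt1.
have sing := card_singular_le R F n.
have energy := fset3_energy_le R A B C.
rewrite leNgt; apply/negP => small.
set q := #|F|%:R in q2 hABC sing energy small.
(* Since [n] is positive, the truncated subtraction is exact. The factor [q] missing from the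
   hypothesis is the one gained from the scarcity of singular matrices. *)
have hq : q * q ^+ (3 * n ^ 2 - 1) = (q ^+ (n ^ 2)) ^+ 3.
  by rewrite -exprS subn1 prednK ?muln_gt0 ?expn_gt0 ?n_gt0 // mulnC exprM.
have Q0 : 0 < q ^+ (n ^ 2) by rewrite exprn_gt0 //; lra.
have hABCq : 4 * (q ^+ (n ^ 2)) ^+ 3 <= (#|A| * #|B| * #|C|)%:R * q.
  by rewrite -hq mulrCA mulrC ler_wpM2r //; lra.
move: (q ^+ (n ^ 2)) Q0 sing energy small hABCq => Q Q0 sing energy small hABCq.
rewrite !natrM in energy hABCq.
move: sing energy small hABCq (ler0n R #|B|) (ler0n R #|fset3 A B C|).
move: (ler0n R #|A|) (ler0n R #|C|).
move: #|A|%:R #|B|%:R #|C|%:R #|fset3 A B C|%:R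
  #|[set D : 'M[F]_n | D \notin unitmx]|%:R.
move=> a b c s g a0 c0 sing energy small hABCq b0 s0.
have Q3 : 0 < Q ^+ 3 by rewrite exprn_gt0.
(* [energy] has [b ^+ 2] on the left and [b] on the right, so one factor is to be cancelled. *)
have b_gt0 : 0 < b by rewrite lt0r b0 andbT;
  apply/eqP => bE; rewrite bE in hABCq; lra.
have qg : a * b * c * q * (Q - s) ^+ 2 <= Q ^+ 3 * s * (q * g).
  have q0 : 0 <= q by lra.
  by rewrite -(ler_pM2l b_gt0); move: (ler_wpM2l q0 energy); lra.
have lower : 4 * Q ^+ 3 * (Q / 2) ^+ 2 < a * b * c * q * (Q - s) ^+ 2.
  apply: (@lt_le_trans _ _ (4 * Q ^+ 3 * (Q - s) ^+ 2)).
    by rewrite ltr_pM2l; nra.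
  by rewrite ler_wpM2r // sqr_ge0.
have upper : Q ^+ 3 * s * (q * g) <= Q ^+ 3 * (Q / 2) * (2 * Q).
  apply: (@le_trans _ _ (Q ^+ 3 * s * (2 * Q))).
    by rewrite ler_wpM2l // mulr_ge0 // ltW.
  by rewrite ler_wpM2r ?ler_wpM2l //; lra.
lra.
Qed.
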